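(* Let $Q=(q_{ij})$ be a symmetric real $n\times n$ matrix, $v\in\mathbb{R}^n$, $A$ a real $m\times n$ matrix and $b\in\mathbb{R}^m$. Consider the constrained problem $$\text{(P)}\qquad \frac12x^TQx+v^Tx\to\min,\qquad Ax=b,\qquad x\in\{0,1\}^n,$$ and, for $\rho>0$, the unconstrained problem $$\text{(P}_\rho)\qquad \frac{1}{2}x^T(Q+\rho A^TA)x+(v-\rho A^Tb)^Tx+\frac{\rho}{2}\|b\|^2\to\min,\qquad x\in\{0,1\}^n.$$ Suppose that problem (P) has an optimal solution. Then there exists a value $\rho_0>0$ such that for all $\rho\ge\rho_0$ the problems (P$_\rho$) and (P) are equivalent. If moreover all entries of $A$ and $b$ are integers, then such a $\rho_0$ can be taken to satisfy the estimate $$\rho_0\le\sum_{i,j=1}^{n}|q_{ij}|+2\sum_{i=1}^{n}|v_i|+2.$$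
   Context: $\|\cdot\|$ is the Euclidean norm. The objective function of (P$_\rho$) equals $\frac12x^TQx+v^Tx+\frac{\rho}{2}\|Ax-b\|^2$. Two such minimization problems are called equivalent if they have the same set of optimal solutions. *)

(* Defs.v *)
From mathcomp Require Import all_boot all_order all_algebra.
From mathcomp Require Import classical_sets reals.

Set Implicit Arguments.
Unset Strict Implicit.
Unset Printing Implicit Defensive.

Import Order.TTheory GRing.Theory Num.Theory.

Local Open Scope classical_set_scope.
Local Open Scope ring_scope.

(* The norm predefined on matrices by mathcomp-analysis is the sup norm. *)
Definition enorm (R : realType) (k : nat) (u : 'cV[R]_k) : R :=
  Num.sqrt (\sum_(i < k) u i 0 ^+ 2).

Record min_problem (R : realType) (T : Type) := MinProblem {
  objective : T -> R;
  feasible : set T }.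

Definition optimal_solutions (R : realType) (T : Type)
    (P : min_problem R T) : set T :=
  [set x | feasible P x /\
           forall y, feasible P y -> objective P x <= objective P y].

Definition equivalent_problems (R : realType) (T : Type)
    (P P' : min_problem R T) : Prop :=
  optimal_solutions P = optimal_solutions P'.

Definition binary_vectors (R : realType) (n : nat) : set 'cV[R]_n :=
  [set x | forall i, x i 0 = 0 \/ x i 0 = 1].

(* Products such as x^T *m Q *m x are 1 x 1 matrices; their value is the
   entry (0, 0). *)
Definition constrained_problem (R : realType) (m n : nat)
    (Q : 'M[R]_n) (v : 'cV[R]_n) (A : 'M[R]_(m, n)) (b : 'cV[R]_m) :
    min_problem R 'cV[R]_n :=
  {| objective := fun x => 2^-1 * (x^T *m Q *m x) 0 0 + (v^T *m x) 0 0;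
     feasible := [set x | A *m x = b /\ binary_vectors x] |}.

Definition penalized_problem (R : realType) (m n : nat)
    (Q : 'M[R]_n) (v : 'cV[R]_n) (A : 'M[R]_(m, n)) (b : 'cV[R]_m) (rho : R) :
    min_problem R 'cV[R]_n :=
  {| objective := fun x =>
       2^-1 * (x^T *m (Q + rho *: (A^T *m A)) *m x) 0 0
       + ((v - rho *: (A^T *m b))^T *m x) 0 0
       + rho / 2 * enorm b ^+ 2;
     feasible := @binary_vectors R n |}.

(* Main.v *)
Require Import Defs.
From mathcomp Require Import all_boot all_order all_algebra.
From mathcomp Require Import classical_sets reals.
From mathcomp Require Import boolp lra ring.

Set Implicit Arguments.
Unset Strict Implicit.
Unset Printing Implicit Defensive.

Import Order.TTheory GRing.Theory Num.Theory.

Local Open Scope ring_scope.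

(** The penalized objective is f(x) + (rho / 2) |Ax - b|^2, where f is the
    objective of the constrained problem [penalized_objectiveE].  On binary
    vectors every monomial x_i x_j or x_i lies between 0 and 1, so f varies by
    at most S / 2 with S = sum |q_ij| + 2 sum |v_i| [objective_range].
    Comparing differences of f, rather than bounding |f| by S / 2 and doubling,
    is what saves the factor 2 needed for the estimate on rho_0.

    If the residual satisfies |Ax - b|^2 >= delta > 0 at every infeasible
    binary vector, the penalty there is at least rho delta / 2, which exceeds
    S / 2 as soon as rho >= (S + 2) / delta.  An infeasible vector then costs
    strictly more than any feasible one, while the penalty vanishes on feasible
    vectors, so the two problems have the same minimizers [exact_penalty].

    A positive delta exists because there are finitely many binary vectors
    [residual_gap].  For integral A and b the squared residual is an integer,
    so that delta = 1 works [int_residual_gap] and rho_0 = S + 2. *)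

Section Penalty.

Variable R : realType.

(** A penalty exceeding the oscillation bound L of f over D at each point
    outside F makes each such point strictly worse than every point of F.
    Nonemptiness of F is essential: otherwise only the penalized problem could
    have minimizers. *)
Lemma exact_penalty (T : Type) (f p : T -> R) (D F : set T) (L : R) :
    (forall x, F x -> D x) -> (exists x, F x) ->
    (forall x y, D x -> D y -> f x - f y <= L) ->
    (forall x, F x -> p x = 0) -> (forall x, D x -> ~ F x -> L < p x) ->
  optimal_solutions (MinProblem (fun x => f x + p x) D) =
  optimal_solutions (MinProblem f F).
Proof.
move=> FD [x0 Fx0] fL p0 pL; rewrite /optimal_solutions /=.
apply/seteqP; split=> x /= [Dx x_min].
  have Fx : F x.
    apply: contrapT => nFx.
    have := x_min _ (FD _ Fx0); have := pL _ Dx nFx.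
    have := fL _ _ (FD _ Fx0) Dx; rewrite (p0 _ Fx0); lra.
  split=> // y Fy; have := x_min _ (FD _ Fy).
  by rewrite !p0 // !addr0.
split=> [|y Dy]; first exact: FD.
rewrite (p0 _ Dx) addr0.
have [Fy|nFy] := pselect (F y); first by rewrite p0 // addr0 x_min.
have := pL _ Dy nFy; have := fL _ _ (FD _ Dx) Dy; lra.
Qed.

Lemma sqr_enorm (k : nat) (u : 'cV[R]_k) : enorm u ^+ 2 = (u^T *m u) 0 0.
Proof.
rewrite sqr_sqrtr; last by apply: sumr_ge0 => i _; exact: sqr_ge0.
by rewrite mxE; apply: eq_bigr => i _; rewrite mxE expr2.
Qed.

Lemma enorm_eq0 (k : nat) (u : 'cV[R]_k) : (enorm u == 0) = (u == 0).
Proof.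
rewrite -sqrf_eq0 sqr_sqrtr; last by apply: sumr_ge0 => i _; exact: sqr_ge0.
rewrite psumr_eq0 => [|i _]; [|exact: sqr_ge0].
apply/allP/eqP => [u0|-> i _]; last by rewrite /= mxE expr0n eqxx.
apply/colP => i; rewrite mxE; apply/eqP.
by have := u0 i (mem_index_enum i); rewrite /= sqrf_eq0.
Qed.

Section Problem.

Variables (m n : nat) (Q : 'M[R]_n) (v : 'cV[R]_n).
Variables (A : 'M[R]_(m, n)) (b : 'cV[R]_m).

Local Notation f := (objective (constrained_problem Q v A b)).
Local Notation coef_bound :=
  (\sum_(i < n) \sum_(j < n) `|Q i j| + 2 * (\sum_(i < n) `|v i 0|)).

(** Expanding the square, the two cross terms x^T A^T b and b^T A x agree, since
    a 1 x 1 matrix equals its transpose. *)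
Lemma penalized_objectiveE (rho : R) (x : 'cV[R]_n) :
  objective (penalized_problem Q v A b rho) x =
  f x + rho / 2 * enorm (A *m x - b) ^+ 2.
Proof.
rewrite /= !sqr_enorm.
have subE (u w : 'M[R]_1) : (u - w) 0 0 = u 0 0 - w 0 0 by rewrite !mxE.
have cross : (x^T *m A^T *m b) 0 0 = (b^T *m A *m x) 0 0.
  by rewrite -[in LHS](trmxK b) -!trmx_mul mxE mulmxA.
have -> : ((A *m x - b)^T *m (A *m x - b)) 0 0 =
    (x^T *m (A^T *m A) *m x) 0 0 - 2 * (b^T *m A *m x) 0 0 + (b^T *m b) 0 0.
  rewrite [(_ - _)^T]linearB /= trmx_mul mulmxBl !mulmxBr !mulmxA.
  rewrite !subE cross; ring.
have -> : ((v - rho *: (A^T *m b))^T *m x) 0 0 =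
    (v^T *m x) 0 0 - rho * (b^T *m A *m x) 0 0.
  rewrite [(_ - _)^T]linearB /= [(_ *: _)^T]linearZ /=.
  by rewrite trmx_mul trmxK mulmxBl -scalemxAl !mxE.
have -> : (x^T *m (Q + rho *: (A^T *m A)) *m x) 0 0 =
    (x^T *m Q *m x) 0 0 + rho * (x^T *m (A^T *m A) *m x) 0 0.
  by rewrite mulmxDr mulmxDl -scalemxAr -scalemxAl !mxE.
lra.
Qed.

(** In f(x) - f(y) each coefficient q_ij / 2 or v_i multiplies a difference of
    two numbers of the unit interval, hence contributes at most its absolute
    value. *)
Lemma objective_range (x y : 'cV[R]_n) :
  binary_vectors x -> binary_vectors y -> f x - f y <= coef_bound / 2.
Proof.
have entry01 z i : binary_vectors z -> 0 <= (z : 'cV[R]_n) i 0 <= 1.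
  by case/(_ i) => ->; rewrite lexx ler01.
have quadE z : (z^T *m Q *m z) 0 0 =
    \sum_(i < n) \sum_(j < n) Q i j * ((z : 'cV[R]_n) i 0 * z j 0).
  rewrite mxE exchange_big /=; apply: eq_bigr => j _.
  by rewrite mxE mulr_suml; apply: eq_bigr => i _; rewrite mxE; ring.
have linE z : (v^T *m z) 0 0 = \sum_(i < n) v i 0 * (z : 'cV[R]_n) i 0.
  by rewrite mxE; apply: eq_bigr => i _; rewrite mxE.
have term_le (c s t : R) : 0 <= s <= 1 -> 0 <= t <= 1 -> c * s - c * t <= `|c|.
  move=> s01 t01; rewrite -mulrBr (le_trans (ler_norm _)) // normrM.
  by rewrite ler_piMr // ler_norml; lra.
move=> bin_x bin_y; rewrite /= !quadE !linE.
set qx := \sum_i \sum_j _; set vx := \sum_i _ * x i 0.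
set qy := \sum_i \sum_j _; set vy := \sum_i _ * y i 0.
have q_le : qx - qy <= \sum_(i < n) \sum_(j < n) `|Q i j|.
  rewrite -sumrB ler_sum // => i _; rewrite -sumrB ler_sum // => j _.
  have [/andP[? ?] /andP[? ?]] := (entry01 x i bin_x, entry01 x j bin_x).
  have [/andP[? ?] /andP[? ?]] := (entry01 y i bin_y, entry01 y j bin_y).
  by apply: term_le; rewrite mulr_ge0 //= mulr_ile1.
have v_le : vx - vy <= \sum_(i < n) `|v i 0|.
  by rewrite -sumrB ler_sum // => i _; apply: term_le; apply: entry01.
lra.
Qed.

(** Uniform in the residual gap delta; an arbitrary A calls for the delta of
    [residual_gap], an integral one for delta = 1. *)
Lemma penalized_equivalent (delta rho : R) :
    (exists x, optimal_solutions (constrained_problem Q v A b) x) ->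
    0 < delta ->
    (forall x, binary_vectors x -> A *m x <> b ->
       delta <= enorm (A *m x - b) ^+ 2) ->
    (coef_bound + 2) / delta <= rho ->
  equivalent_problems (penalized_problem Q v A b rho)
                      (constrained_problem Q v A b).
Proof.
move=> [x0 [Fx0 _]] delta_gt0 gap; rewrite ler_pdivrMr // => rho_ge.
have S_ge0 : 0 <= coef_bound.
  by rewrite addr_ge0 ?mulr_ge0 ?sumr_ge0 // => i _; rewrite sumr_ge0.
have rho_gt0 : 0 < rho.
  by rewrite -(pmulr_lgt0 _ delta_gt0); lra.
rewrite /equivalent_problems.
have -> : penalized_problem Q v A b rho =
    MinProblem (fun x => f x + rho / 2 * enorm (A *m x - b) ^+ 2)
               (@binary_vectors R n).
  by congr MinProblem; apply: funext => x; exact: penalized_objectiveE.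
apply: (@exact_penalty _ _ _ _ _ (coef_bound / 2)).
- by move=> x [].
- by exists x0.
- exact: objective_range.
- move=> x [-> _]; rewrite subrr.
  have /eqP -> : enorm (0 : 'cV[R]_m) == 0 by rewrite enorm_eq0.
  by rewrite expr0n mulr0.
- move=> x bx nFx.
  have /(gap _ bx) : A *m x <> b by move=> Axb; apply: nFx.
  rewrite -(ler_pM2l rho_gt0); lra.
Qed.

(** Binary vectors are indexed by the finite type of boolean functions, and
    delta is the minimum of finitely many positive squared residuals. *)
Lemma residual_gap : exists2 delta : R, 0 < delta &
  forall x, binary_vectors x -> A *m x <> b ->
    delta <= enorm (A *m x - b) ^+ 2.
Proof.
pose vec (s : {ffun 'I_n -> bool}) : 'cV[R]_n := \col_i (s i)%:R.
(* The default value 1 serves when every binary vector is feasible. *)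
exists (\big[Num.min/1]_(s | A *m vec s != b) enorm (A *m vec s - b) ^+ 2).
  apply: lt_bigmin => // s; rewrite -subr_eq0 -enorm_eq0 => nz.
  by rewrite exprn_gt0 // lt_def nz sqrtr_ge0.
move=> x bx /eqP Axb.
have xE : x = vec [ffun i => x i 0 == 1].
  apply/colP => i; rewrite !mxE ffunE.
  by case: (bx i) => ->; rewrite ?eqxx // eq_sym oner_eq0.
by rewrite xE in Axb *; apply: bigmin_le_cond.
Qed.

(** The squared residual is a nonzero integer, hence at least 1. *)
Lemma int_residual_gap : A \is a mxOver Num.int -> b \is a mxOver Num.int ->
  forall x, binary_vectors x -> A *m x <> b -> 1 <= enorm (A *m x - b) ^+ 2.
Proof.
move=> A_int b_int x bx Axb.
have x_int : x \is a mxOver Num.int.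
  by apply/mxOverP => i j; rewrite ord1; case: (bx i) => ->.
have r_int i : (A *m x - b) i 0 \is a Num.int.
  have /mxOverP Ax_int := mxOverM A_int x_int.
  move/mxOverP: b_int => b_int.
  have -> : (A *m x - b) i 0 = (A *m x) i 0 - b i 0.
    by rewrite mxE [(- b) _ _]mxE.
  exact: rpredB.
have sq_int : enorm (A *m x - b) ^+ 2 \is a Num.int.
  by rewrite sqr_enorm mxE rpred_sum // => i _; rewrite [_^T _ _]mxE rpredM.
have : enorm (A *m x - b) ^+ 2 != 0.
  by rewrite sqrf_eq0 enorm_eq0 subr_eq0; apply/eqP.
by move/(norm_intr_ge1 sq_int); rewrite ger0_norm ?sqr_ge0.
Qed.

End Problem.

End Penalty.

Theorem mainTheorem4 (R : realType) (m n : nat)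
    (Q : 'M[R]_n) (v : 'cV[R]_n) (A : 'M[R]_(m, n)) (b : 'cV[R]_m)
    (Q_sym : Q^T = Q)
    (P_solvable : exists x, optimal_solutions (constrained_problem Q v A b) x) :
  (exists rho0 : R, 0 < rho0 /\
     forall rho : R, rho0 <= rho ->
       equivalent_problems (penalized_problem Q v A b rho)
                           (constrained_problem Q v A b))
  /\
  (A \is a mxOver Num.int -> b \is a mxOver Num.int ->
   exists rho0 : R, 0 < rho0 /\
     (forall rho : R, rho0 <= rho ->
        equivalent_problems (penalized_problem Q v A b rho)
                            (constrained_problem Q v A b)) /\
     rho0 <= \sum_(i < n) \sum_(j < n) `|Q i j| + 2 * (\sum_(i < n) `|v i 0|) + 2).
Proof.
set S := \sum_(i < n) _ + _.
have S_ge0 : 0 <= S.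
  by rewrite addr_ge0 ?mulr_ge0 ?sumr_ge0 // => i _; rewrite sumr_ge0.
have S2_gt0 : 0 < S + 2 by rewrite ltr_wpDl.
split=> [|A_int b_int].
  have [delta delta_gt0 gap] := residual_gap A b.
  exists ((S + 2) / delta).
  split=> [|rho]; first exact: divr_gt0.
  exact: penalized_equivalent.
exists (S + 2).
split=> //; split=> // rho rho_ge.
apply: (penalized_equivalent P_solvable ltr01); last by rewrite divr1.
exact: int_residual_gap.
Qed.
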